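(* Let $K,M,N_{\mathrm{test}}\ge 1$ be integers and $\alpha\in(0,1)$. Let $\mathcal{D}_i=(\mathbf{u}_i,(\mathbf{y}_{ij},s_{ij})_{j=1}^{M})$, $i=1,\dots,K+N_{\mathrm{test}}$, be random units, where $\mathbf{u}_i\in\mathbb{R}^{d_u}$ is a (discretized) input function, $\mathbf{y}_{ij}\in\mathbb{R}^{d_y}$ are its $M$ query coordinates and $s_{ij}\in\mathbb{R}$ are the corresponding ground-truth values; the first $K$ units are the calibration units and the others are the test units. Let the trained ensemble (trained on data disjoint from the calibration and test units) and its inference mechanism be fixed, i.e. condition on them, and assume that conditionally on them the $K+N_{\mathrm{test}}$ units are jointly exchangeable; no assumption is made on the joint distribution of the $M$ queries within a unit. Let $C_\alpha(\mathbf{u},\mathbf{y})$ be the prediction interval built from the ensemble and from the $KM$ calibration scores as defined in the context. Then for any test unit, written $(\mathbf{u}_*,(\mathbf{y}_{*,j},s_{*,j})_{j=1}^{M})$, with $r=\lfloor (KM-1)(1-\alpha)\rfloor+1$, $$\mathbb{E}\left[\frac{1}{M}\sum_{j=1}^{M}\mathbf{1}\left\{s_{*,j}\in C_\alpha(\mathbf{u}_*,\mathbf{y}_{*,j})\right\}\right]\ \ge\ \frac{r}{(K+1)M},$$ where the expectation is over the calibration and test units, conditional on the trained ensemble and the fixed inference mechanism.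
   Context: Ensemble. The trained ensemble consists of $L\ge 1$ models $\mathcal{G}_{\theta_1},\dots,\mathcal{G}_{\theta_L}$, each assigning to an input $\mathbf{u}\in\mathbb{R}^{d_u}$ and query $\mathbf{y}\in\mathbb{R}^{d_y}$ a real number $\mathcal{G}_{\theta_\ell}(\mathbf{u})(\mathbf{y})$. After conditioning on the trained ensemble and the fixed inference mechanism, these are fixed measurable functions of $(\mathbf{u},\mathbf{y})$, the same for all units. Define $$\mu(\mathbf{u})(\mathbf{y})=\frac1L\sum_{\ell=1}^{L}\mathcal{G}_{\theta_\ell}(\mathbf{u})(\mathbf{y}),\qquad \sigma(\mathbf{u})(\mathbf{y})=\sqrt{\frac1L\sum_{\ell=1}^{L}\bigl(\mathcal{G}_{\theta_\ell}(\mathbf{u})(\mathbf{y})-\mu(\mathbf{u})(\mathbf{y})\bigr)^2},\qquad \tilde\sigma(\mathbf{u})(\mathbf{y})=\sigma(\mathbf{u})(\mathbf{y})+\epsilon,$$ where $\epsilon>0$ is a fixed constant. Scores. The nonconformity score of query $j$ of unit $i$ is $$R_{ij}=\frac{|s_{ij}-\mu(\mathbf{u}_i)(\mathbf{y}_{ij})|}{\tilde\sigma(\mathbf{u}_i)(\mathbf{y}_{ij})}.$$ Threshold. Let $N_{\mathrm{cal}}=KM$ and let $R^{\mathrm{cal}}_{(1)}\le\dots\le R^{\mathrm{cal}}_{(N_{\mathrm{cal}})}$ be the calibration scores $\{R_{ij}:1\le i\le K,\ 1\le j\le M\}$ in increasing order. Put $a=(N_{\mathrm{cal}}-1)(1-\alpha)$,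 $r=\lfloor a\rfloor+1$, $\gamma=a-\lfloor a\rfloor$, and $$\widehat q=(1-\gamma)R^{\mathrm{cal}}_{(r)}+\gamma R^{\mathrm{cal}}_{(r+1)}$$ (the linearly interpolated empirical $(1-\alpha)$-quantile; when $\gamma=0$ this is just $R^{\mathrm{cal}}_{(r)}$). Prediction interval. $$C_\alpha(\mathbf{u},\mathbf{y})=\left[\mu(\mathbf{u})(\mathbf{y})-\widehat q\,\tilde\sigma(\mathbf{u})(\mathbf{y}),\ \mu(\mathbf{u})(\mathbf{y})+\widehat q\,\tilde\sigma(\mathbf{u})(\mathbf{y})\right].$$ Jointly exchangeable means that the joint distribution of the sequence of units $(\mathcal{D}_1,\dots,\mathcal{D}_{K+N_{\mathrm{test}}})$ is invariant under every permutation of the unit index $i$. *)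

(* Defs.v *)
From mathcomp Require Import all_boot all_order all_algebra fingroup perm.
From mathcomp Require Import all_classical all_reals all_analysis.

Set Implicit Arguments.
Unset Strict Implicit.
Unset Printing Implicit Defensive.

Import Order.TTheory GRing.Theory Num.Theory.
Import numFieldNormedType.Exports.

Local Open Scope classical_set_scope.
Local Open Scope ring_scope.

(* R^n is rendered as n.-tuple R rather than 'rV[R]_n: tuples carry the product
   sigma-algebra (i.e. the Borel sets of R^n) in the library, row vectors
   carry no measurable structure. *)

(* A unit (u, (y_j, s_j)_j) with M queries. *)
Notation unit_space R du dy M :=
  (du.-tuple R * M.-tuple (dy.-tuple R * R))%type.

Section exchangeability.
Context {d d' : measure_display} {T : measurableType d}
  {T' : measurableType d'} {R : realType}.

Definition exchangeable (P : probability T R) (n : nat)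
    (X : 'I_n -> {RV P >-> T'}) : Prop :=
  forall (s : 'S_n) (A : set (n.-tuple T')), measurable A ->
    pushforward P (fun w => [tuple X (s i) w | i < n]) A =
    pushforward P (fun w => [tuple X i w | i < n]) A.

End exchangeability.
Arguments exchangeable {d d' T T' R} P {n} X.

Section unit_components.
Context {R : realType} {du dy M : nat}.
Implicit Types (x : unit_space R du dy M) (j : 'I_M).

Definition input_of x : du.-tuple R := x.1.
Definition query_of x j : dy.-tuple R := (tnth x.2 j).1.
Definition truth_of x j : R := (tnth x.2 j).2.

End unit_components.

Section ensemble.
Context {R : realType} {du dy L : nat}.
Variable G : 'I_L -> du.-tuple R -> dy.-tuple R -> R.
Variable eps : R.
Implicit Types (u : du.-tuple R) (y : dy.-tuple R).

Definition ens_mean u y : R := L%:R^-1 * \sum_(l < L) G l u y.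

Definition ens_std u y : R :=
  Num.sqrt (L%:R^-1 * \sum_(l < L) (G l u y - ens_mean u y) ^+ 2).

Definition ens_scale u y : R := ens_std u y + eps.

Definition score {M : nat} (x : unit_space R du dy M) (j : 'I_M) : R :=
  `|truth_of x j - ens_mean (input_of x) (query_of x j)|
    / ens_scale (input_of x) (query_of x j).

Definition pred_interval (q : R) u y : set R :=
  `[ens_mean u y - q * ens_scale u y, ens_mean u y + q * ens_scale u y].

End ensemble.

Section interpolated_quantile.
Context {R : realType}.
Variable alpha : R.

Definition quantile_pos (n : nat) : R := (n%:R - 1) * (1 - alpha).

(* [Num.truncn] is the nat-valued floor on nonnegative reals, and
   [quantile_pos n] is nonnegative for 1 <= n and alpha <= 1. *)
Definition quantile_rank (n : nat) : nat := (Num.truncn (quantile_pos n)).+1.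

Definition quantile_frac (n : nat) : R :=
  quantile_pos n - (Num.truncn (quantile_pos n))%:R.

(* k-th smallest entry, 1 <= k <= size s; 0 when k > size s. *)
Definition order_stat (s : seq R) (k : nat) : R := nth 0 (sort <=%R s) k.-1.

(* For 0 < alpha < 1 the rank r + 1 exceeds size s only when size s = 1, and
   then its weight quantile_frac is 0. *)
Definition interp_quantile (s : seq R) : R :=
  (1 - quantile_frac (size s)) * order_stat s (quantile_rank (size s))
  + quantile_frac (size s) * order_stat s (quantile_rank (size s)).+1.

End interpolated_quantile.

Section calibration.
Context {R : realType} {du dy L M K N : nat}.
Variable G : 'I_L -> du.-tuple R -> dy.-tuple R -> R.
Variables eps alpha : R.
Implicit Type x : 'I_(K + N) -> unit_space R du dy M.

(* The K calibration units are those with index [lshift N i], i : 'I_K; the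
   test units are those with index [rshift K t], t : 'I_N. *)
Definition cal_scores x : seq R :=
  [seq score G eps (x (lshift N i)) j | i <- enum 'I_K, j <- enum 'I_M].

Definition threshold x : R := interp_quantile alpha (cal_scores x).

Definition conformal_interval x (u : du.-tuple R)
    (y : dy.-tuple R) : set R :=
  pred_interval G eps (threshold x) u y.

End calibration.

(* Main.v *)
(* Pool the K calibration units with the test unit, and call a query low-ranked
   when fewer than r of the (K+1)M pooled scores lie strictly below its score.
   At least r pooled queries are low-ranked.  The pooled rank is equivariant
   under permutations of the pooled units, so exchanging the test unit with a
   calibration unit shows that every pooled unit has the same expected number of
   low-ranked queries, hence at least r/(K+1).  Finally a low-ranked test query
   is covered: fewer than r calibration scores lie strictly below its score,
   which is therefore at most the r-th calibration order statistic, itself at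
   most the interpolated quantile. *)

Require Import Defs.
From mathcomp Require Import all_boot all_order all_algebra fingroup perm.
From mathcomp Require Import all_classical all_reals all_analysis.
From mathcomp Require Import measurable_realfun.
Import Order.TTheory GRing.Theory Num.Theory.
Import numFieldNormedType.Exports.
Local Open Scope classical_set_scope.
Local Open Scope ring_scope.

Set Implicit Arguments.
Unset Strict Implicit.
Unset Printing Implicit Defensive.

(** * Ranks in finite families *)

(** Ranks start at 0, and tied points share the smallest rank available to them, so ties only
    enlarge the set of points of rank below [r]. *)
Definition rank_in {disp : Order.disp_t} {T : orderType disp} {I : finType}
    (A : {pred I}) (f : I -> T) (p : I) : nat :=
  #|[pred q in A | (f q < f p)%O]|.

(* A minimizer of f among the elements of A of rank at least r would have all
   smaller elements of A among the low-ranked ones, hence have low rank. *)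
Lemma card_rank_lt (disp : Order.disp_t) (T : orderType disp) (I : finType)
    (A : {pred I}) (f : I -> T) (r : nat) :
  (r <= #|A|)%N -> (r <= #|[pred p in A | rank_in A f p < r]|)%N.
Proof.
move=> rA; set B := [pred p in A | _]; rewrite leqNgt; apply/negP => Br.
have /fintype.subsetPn[i0 Ai0 Bi0] : ~~ (A \subset B).
  by apply: contraL (leq_trans Br rA) => /subset_leq_card; rewrite -leqNgt.
have : [pred i in A | i \notin B] i0 by rewrite /= Ai0.
case/(arg_minP f) => m /andP[Am /negP Bm] mmin; apply: Bm.
rewrite inE Am /= (leq_ltn_trans _ Br)//.
apply/subset_leq_card/fintype.subsetP => q.
rewrite inE => /andP[Aq]; rewrite ltNge; apply: contraNT => Bq.
by apply: mmin; rewrite /= Aq.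
Qed.

(** Equivariance of the rank: reindexing along [h], which preserves membership in [A], matches the
    points counted on the two sides. *)
Lemma rank_in_comp (disp : Order.disp_t) (T : orderType disp) (I : finType)
    (A : {pred I}) (f : I -> T) (h : I -> I) (p : I) :
  bijective h -> {mono h : q / q \in A} ->
  rank_in A (f \o h) p = rank_in A f (h p).
Proof.
move=> bij_h hA; rewrite /rank_in -!sum1_card.
rewrite [RHS](reindex h) /=; last exact: onW_bij.
by apply: eq_bigl => q; rewrite !inE hA.
Qed.

(** * Order statistics and the interpolated quantile *)

(** After sorting, the entries below [v] form an initial segment, which is too short to reach
    position [r.-1]. *)
Lemma ler_order_stat (R : realType) (v : R) (s : seq R) (r : nat) :
  (r <= size s)%N -> (count (< v)%R s < r)%N -> v <= order_stat s r.
Proof.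
case: r => // r rs cr; apply: nth_count_ge; first exact: (sort_sorted le_total).
have /seq.permP -> : perm_eq (sort <=%R s) s by rewrite perm_sort.
by rewrite size_sort -ltnS cr.
Qed.

Lemma quantile_pos_ge0 (R : realType) (alpha : R) (n : nat) :
  alpha < 1 -> (0 < n)%N -> 0 <= quantile_pos alpha n.
Proof. by move=> a1 n0; rewrite mulr_ge0// subr_ge0 ?ler1n// ltW. Qed.

Lemma quantile_rank_le (R : realType) (alpha : R) (n : nat) :
  0 < alpha -> alpha < 1 -> (0 < n)%N -> (quantile_rank alpha n <= n)%N.
Proof.
move=> a0 a1 n0; rewrite /quantile_rank -(ltr_nat R).
have := quantile_pos_ge0 a1 n0; rewrite -truncn_le => /le_lt_trans; apply.
rewrite /quantile_pos (@le_lt_trans _ _ (n%:R - 1))//; last first.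
  by rewrite ltrBlDr ltrDl.
by rewrite ler_piMr ?subr_ge0 ?ler1n// gerBl ltW.
Qed.

(** Guarantees that the upper order statistic of the interpolation is a true entry: for [n > 1] the
    position [(n - 1) * (1 - alpha)] falls strictly short of [n - 1]. *)
Lemma quantile_rank_lt (R : realType) (alpha : R) (n : nat) :
  0 < alpha -> alpha < 1 -> (1 < n)%N -> (quantile_rank alpha n < n)%N.
Proof.
move=> a0 a1 n1; have n0 := ltnW n1; rewrite /quantile_rank.
rewrite -ltn_predRL -(ltr_nat R).
have := quantile_pos_ge0 a1 n0; rewrite -truncn_le => /le_lt_trans; apply.
rewrite /quantile_pos (_ : n.-1%:R = n%:R - 1); last by rewrite -subn1 natrB.
by rewrite gtr_pMr ?gtrBl// subr_gt0 ltr1n.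
Qed.

Lemma order_stat_le_interp_quantile (R : realType) (alpha : R) (s : seq R) :
  0 < alpha -> alpha < 1 -> (0 < size s)%N ->
  order_stat s (quantile_rank alpha (size s)) <= interp_quantile alpha s.
Proof.
move=> a0 a1; rewrite /interp_quantile.
set r := quantile_rank _ _; set g := quantile_frac _ _.
(* With a single entry, [order_stat s 2] is the default 0, possibly below that entry; monotonicity
   is then replaced by the vanishing of the weight [g]. *)
rewrite leq_eqVlt => /orP[/eqP s1|s1].
  suff -> : g = 0 by rewrite subr0 mul1r mul0r addr0.
  by rewrite /g /quantile_frac /quantile_pos -s1 subrr mul0r truncn0 subrr.
have g0 : 0 <= g.
  by rewrite subr_ge0 truncn_le quantile_pos_ge0// ltnW.
have rs : (r < size s)%N by exact: quantile_rank_lt.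
have : order_stat s r <= order_stat s r.+1.
  apply: (sorted_leq_nth le_trans le_refl) => //;
    rewrite ?inE ?size_sort ?(ltnW rs)//; exact: (sort_sorted le_total).
move=> /(ler_wpM2l g0); rewrite [(1 - g) * _]mulrBl mul1r -addrA lerDl.
by rewrite addrC subr_ge0.
Qed.

(** * Integration and measurability *)

(* Unlike [ge0_le_integral], this needs no measurability, so the coverage
   indicators need not be shown measurable. *)
Lemma ge0_le_integralT (d : measure_display) (T : measurableType d)
    (R : realType) (mu : {measure set T -> \bar R}) (f g : T -> \bar R) :
  (forall x, 0 <= f x)%E -> (forall x, f x <= g x)%E ->
  (\int[mu]_x f x <= \int[mu]_x g x)%E.
Proof.
move=> f0 fg; have g0 x : (0 <= g x)%E by exact: le_trans (f0 x) (fg x).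
rewrite !ge0_integralTE//; apply: ereal_sup_le => _ [h hf <-].
by exists h => // x; exact: le_trans (hf x) (fg x).
Qed.

(** For positive [f], the condition [a < (f x)^-1] reads [a * f x < 1], and the open rays to the
    right generate the Borel sets. *)
Lemma measurable_funV_gt0 (d : measure_display) (T : measurableType d)
    (R : realType) (f : T -> R) :
  (forall x, 0 < f x) -> measurable_fun setT f ->
  measurable_fun setT (fun x => (f x)^-1).
Proof.
move=> f0 mf; apply: (measurability _ (RGenOInfty.measurableE R)).
move=> _ [_ [a ->] <-].
rewrite setTI preimage_itvoy.
rewrite (_ : [set _ | _] = (fun x => a * f x < 1) @^-1` [set true]).
  rewrite -[X in measurable X]setTI.
  by apply: measurable_fun_ltr => //; exact: measurable_funM.
by apply/seteqP; split=> x /=; rewrite -ltr_pdivlMr// mul1r.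
Qed.

(** The rank is a finite sum of indicators of the measurable events [f x q < f x p]. *)
Lemma measurable_rank_in_lt (d : measure_display) (T : measurableType d)
    (R : realType) (I : finType) (A : {pred I}) (f : T -> I -> R)
    (p : I) (r : nat) :
  (forall q, measurable_fun setT (f^~ q)) ->
  measurable [set x | (rank_in A (f x) p < r)%N].
Proof.
move=> mf.
pose g x : R := \sum_(q <- enum A) \1_[set y | f y q < f y p] x.
have gE x : g x = (rank_in A (f x) p)%:R.
  rewrite /g big_enum_cond /rank_in -sum1_card natr_sum big_mkcondr /=.
  rewrite [RHS]big_mkcondr /=.
  apply: eq_bigr => q _; rewrite indicE.
  by case: ifPn => h; [rewrite mem_set | rewrite memNset//; apply/negP].
rewrite (_ : [set _ | _] = (fun x => g x < r%:R) @^-1` [set true]).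
  rewrite -[X in measurable X]setTI; apply: measurable_fun_ltr => //.
  apply: measurable_sum => q; apply: measurable_indic.
  rewrite (_ : [set _ | _] = (fun y => f y q < f y p) @^-1` [set true])//.
  by rewrite -[X in measurable X]setTI; apply: measurable_fun_ltr.
by apply/seteqP; split => x /=; rewrite gE ltr_nat.
Qed.

(** * Rank probabilities under exchangeability *)

Section exchangeable_ranks.
Context {d d' : measure_display} {Omega : measurableType d}
  {T' : measurableType d'} {R : realType} {P : probability Omega R}.
Context {n M : nat} (X : 'I_n -> {RV P >-> T'}) (V : T' -> 'I_M -> R).
Hypothesis X_exch : exchangeable P X.
Hypothesis mV : forall j, measurable_fun setT (V^~ j).
Variables (J : {pred 'I_n}) (r : nat).

(** Exchangeability concerns all [n] units, but ranks are taken inside a pool [J], which lets the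
    other test units be left out. *)
Definition low_rank (q : 'I_n * 'I_M) : set Omega :=
  [set w | (rank_in [pred p : 'I_n * 'I_M | p.1 \in J]
              (fun p => V (X p.1 w) p.2) q < r)%N].

Lemma measurable_low_rank q : measurable (low_rank q).
Proof.
apply: measurable_rank_in_lt => p.
exact: (measurableT_comp (mV p.2)).
Qed.

(** Transposing [i] and [i'] preserves [J] and turns the rank of [(i', j)] into that of [(i, j)],
    while the law of the tuple of units is unchanged. *)
Lemma probability_low_rank i i' j :
  i \in J -> i' \in J -> P (low_rank (i, j)) = P (low_rank (i', j)).
Proof.
move=> Ji Ji'.
pose A : set (n.-tuple T') :=
  [set x | (rank_in [pred p : 'I_n * 'I_M | p.1 \in J]
              (fun p => V (tnth x p.1) p.2) (i', j) < r)%N].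
have mA : measurable A.
  apply: measurable_rank_in_lt => q.
  exact: (measurableT_comp (mV q.2) (@measurable_tnth _ _ n q.1)).
(* The transposition acts on units only; the query index stays fixed. *)
pose h (q : 'I_n * 'I_M) := (tperm i i' q.1, q.2).
have hK : involutive h by move=> [a b]; rewrite /h /= tpermK.
have hJ : {mono h : q / q \in [pred p | p.1 \in J]}.
  by move=> [a b]; rewrite !inE /=; case: tpermP => [->|->|//]; rewrite Ji Ji'.
have pre (Y : 'I_n -> Omega -> T') : (fun w => [tuple Y k w | k < n]) @^-1` A =
    [set w | (rank_in [pred p : 'I_n * 'I_M | p.1 \in J]
                (fun p => V (Y p.1 w) p.2) (i', j) < r)%N].
  apply/funext => w; rewrite /A /preimage /=.
  congr (is_true (rank_in _ _ _ < r)%N).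
  by apply/funext => p; rewrite tnth_mktuple.
have := X_exch (tperm i i') mA; rewrite /pushforward.
rewrite (pre X) (pre (fun k => X (tperm i i' k))) => <-; congr (P _).
apply/funext => w; rewrite /low_rank /=; congr (is_true (_ < r)%N).
by rewrite -[in LHS](tpermR i i') -(rank_in_comp _ (i', j) (inv_bij hK) hJ).
Qed.

Lemma sum_probability_low_rank_ge i :
  i \in J -> (r <= #|J| * M)%N ->
  ((r%:R / #|J|%:R)%:E <= \sum_(j < M) P (low_rank (i, j)))%E.
Proof.
move=> Ji rJ.
have J0 : (0 < #|J|)%N by apply/card_gt0P; exists i.
pose A := [pred p : 'I_n * 'I_M | p.1 \in J].
have cardA : #|A| = (#|J| * M)%N.
  rewrite -[M in RHS]card_ord -cardX; apply: eq_card => -[a b].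
  by rewrite !inE andbT.
pose g q w : R := \1_(low_rank q) w.
have mg q : measurable_fun setT (EFin \o g q).
  by apply/measurable_EFinP; exact/measurable_indic/measurable_low_rank.
(* Outcome by outcome, at least [r] pooled queries are low-ranked; this bound is integrated. *)
have : (\int[P]_w (r%:R)%:E <= \int[P]_w \sum_(q <- enum A) (g q w)%:E)%E.
  apply: ge0_le_integralT => w; first by rewrite lee_fin.
  rewrite sumEFin lee_fin big_enum.
  rewrite /g; under eq_bigr do rewrite indicE.
  rewrite -natr_sum ler_nat.
  have := card_rank_lt (fun p => V (X p.1 w) p.2) (r := r) (A := A).
  rewrite cardA => /(_ rJ) /leq_trans; apply.
  rewrite -sum1_card big_mkcondr /=; apply: leq_sum => q _.
  by case: ifPn => // h; rewrite mem_set.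
rewrite integral_cst// [X in (_ * X)%E]probability_setT mule1.
rewrite ge0_integral_sum//; last by move=> q w _; rewrite lee_fin.
have gI q : (\int[P]_x (g q x)%:E = P (low_rank q))%E.
  by rewrite integral_indic ?setIT//; exact: measurable_low_rank.
under eq_bigr do rewrite gI.
(* The trivial conjunct gives the product form that [pair_big] splits into units and queries; each
   unit of the pool then contributes the same sum as [i]. *)
rewrite big_enum /= (eq_bigl (fun p => (p.1 \in J) && true)); last first.
  by move=> p; rewrite andbT inE.
rewrite -(pair_big (mem J) xpredT (fun a j => P (low_rank (a, j)))) /=.
under eq_bigr => a Ja.
  rewrite (eq_bigr (fun j => P (low_rank (i, j)))); last first.
    by move=> j _; exact: probability_low_rank.
  over.
(* Probabilities are finite, so the division by [#|J|] can be carried out in the reals. *)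
have -> : (\sum_(j < M) P (low_rank (i, j)) =
    (\sum_(j < M) fine (P (low_rank (i, j))))%:E)%E.
  rewrite -sumEFin; apply: eq_bigr => j _; rewrite fineK//.
  exact/fin_num_measure/measurable_low_rank.
by rewrite sumEFin !lee_fin sumr_const ler_pdivrMr ?ltr0n// mulr_natr.
Qed.

End exchangeable_ranks.

(** * Ensemble scores and prediction intervals *)

Section ensemble_score.
Context {R : realType} {du dy L M : nat}.
Variables (G : 'I_L -> du.-tuple R -> dy.-tuple R -> R) (eps : R).
Hypothesis eps_gt0 : 0 < eps.

Lemma ens_scale_gt0 u y : 0 < ens_scale G eps u y.
Proof. by rewrite ltr_wpDl// sqrtr_ge0. Qed.

Lemma score_le_pred_interval (x : unit_space R du dy M) (j : 'I_M) (q : R) :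
  score G eps x j <= q ->
  pred_interval G eps q (input_of x) (query_of x j) (truth_of x j).
Proof.
rewrite /score ler_pdivrMr ?ens_scale_gt0// ler_norml lerBrDl.
by rewrite /pred_interval /= in_itv /= !lerBlDl.
Qed.

Hypothesis G_meas : forall l : 'I_L,
  measurable_fun [set: (du.-tuple R * dy.-tuple R)%type]
    (fun p => G l p.1 p.2).

Lemma measurable_score (j : 'I_M) :
  measurable_fun setT (fun x : unit_space R du dy M => score G eps x j).
Proof.
have mt : measurable_fun setT (fun x : unit_space R du dy M => tnth x.2 j).
  exact: (measurableT_comp (measurable_tnth j) measurable_snd).
have mp : measurable_fun setT
    (fun x : unit_space R du dy M => (input_of x, query_of x j)).
  apply: measurable_fun_pair; first exact: measurable_fst.
  exact: (measurableT_comp measurable_fst mt).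
have mG l := measurableT_comp (G_meas l) mp.
have mmean : measurable_fun setT (fun x : unit_space R du dy M =>
    ens_mean G (input_of x) (query_of x j)).
  by apply: measurable_funM => //; exact: measurable_sum.
apply: measurable_funM.
  apply: measurableT_comp => //; apply: measurable_funB => //.
  exact: (measurableT_comp measurable_snd mt).
apply: measurable_funV_gt0 => [x|]; first exact: ens_scale_gt0.
apply: measurable_funD => //.
apply: (measurableT_comp (continuous_measurable_fun (@sqrt_continuous R))).
apply: measurable_funM => //; apply: measurable_sum => l.
by apply: measurable_funX; exact: (measurable_funB (mG l) mmean).
Qed.

End ensemble_score.

(** * The pool of calibration units and one test unit *)

Section calibration_pool.
Context {R : realType} {du dy L M K N : nat}.
Variables (G : 'I_L -> du.-tuple R -> dy.-tuple R -> R) (eps alpha : R).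
Implicit Type x : 'I_(K + N) -> unit_space R du dy M.

Definition cal_or_test (t : 'I_N) : pred 'I_(K + N) :=
  [pred i : 'I_(K + N) | (i < K)%N || (i == rshift K t)].

Lemma card_cal_or_test t : #|cal_or_test t| = K.+1.
Proof.
rewrite -sum1_card big_split_ord /= (eq_bigl xpredT); last first.
  by move=> i; rewrite inE /= ltn_ord.
rewrite sum1_card card_ord (eq_bigl (pred1 t)) ?big_pred1_eq ?addn1// => i.
by rewrite inE /= ltnNge leq_addr eq_shift.
Qed.

Lemma size_cal_scores x : size (cal_scores G eps x) = (K * M)%N.
Proof. by rewrite size_allpairs !size_enum_ord. Qed.

Lemma count_cal_scores_le x t q :
  (count (< score G eps (x q.1) q.2)%R (cal_scores G eps x) <=
   rank_in [pred p : 'I_(K + N) * 'I_M | p.1 \in cal_or_test t]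
     (fun p => score G eps (x p.1) p.2) q)%N.
Proof.
set v := score _ _ _ _.
rewrite -sum1_count big_mkcond big_allpairs_dep big_enum /=.
rewrite /rank_in -sum1_card.
rewrite [leqRHS](_ : _ = \sum_i \sum_j
    if (i \in cal_or_test t) && (score G eps (x i) j < v)%R then 1 else 0)%N;
  last first.
  by rewrite pair_bigA big_mkcond; apply: eq_bigr => -[i j] _; rewrite !inE.
(* The pooled count splits into calibration and test units; the nonnegative test part is dropped. *)
rewrite big_split_ord /=; apply: leq_trans (leq_addr _ _).
apply: leq_sum => i _.
rewrite big_enum; apply: leq_sum => j _.
by rewrite inE /= ltn_ord.
Qed.

Hypotheses (alpha_gt0 : 0 < alpha) (alpha_lt1 : alpha < 1).
Hypotheses (K_gt0 : (0 < K)%N) (M_gt0 : (0 < M)%N).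

Lemma score_le_threshold x t q :
  (rank_in [pred p : 'I_(K + N) * 'I_M | p.1 \in cal_or_test t]
     (fun p => score G eps (x p.1) p.2) q < quantile_rank alpha (K * M))%N ->
  score G eps (x q.1) q.2 <= threshold G eps alpha x.
Proof.
move=> /(leq_ltn_trans (count_cal_scores_le x t q)) cr.
have KM0 : (0 < K * M)%N by rewrite muln_gt0 K_gt0.
apply: le_trans (order_stat_le_interp_quantile _ _ _) => //.
  by apply: ler_order_stat; rewrite size_cal_scores// quantile_rank_le.
by rewrite size_cal_scores.
Qed.

End calibration_pool.

(** * The coverage bound *)

Theorem theorem1 (R : realType) (d : measure_display) (Omega : measurableType d)
  (P : probability Omega R)
  (K M Ntest L du dy : nat)
  (K_ge1 : (1 <= K)%N) (M_ge1 : (1 <= M)%N) (Ntest_ge1 : (1 <= Ntest)%N)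
  (L_ge1 : (1 <= L)%N)
  (alpha : R) (alpha_gt0 : 0 < alpha) (alpha_lt1 : alpha < 1)
  (eps : R) (eps_gt0 : 0 < eps)
  (G : 'I_L -> du.-tuple R -> dy.-tuple R -> R)
  (G_meas : forall l : 'I_L,
     measurable_fun [set: (du.-tuple R * dy.-tuple R)%type]
       (fun p => G l p.1 p.2))
  (D : 'I_(K + Ntest) -> {RV P >-> unit_space R du dy M})
  (D_exch : exchangeable P D)
  (t : 'I_Ntest) :
  (((quantile_rank alpha (K * M))%:R / (K.+1 * M)%:R)%:E <=
  'E_P[fun w =>
    let xs := fun i => D i w in
    let x := D (rshift K t) w in
    (M%:R^-1 * \sum_(j < M)
      \1_(conformal_interval G eps alpha xs (input_of x) (query_of x j))
        (truth_of x j))%R])%E.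
Proof.
rewrite unlock /=.
set F := low_rank D (score G eps) (cal_or_test t) (quantile_rank alpha (K * M)).
have mV := measurable_score (M := M) eps_gt0 G_meas.
have mF q : measurable (F q) by exact: measurable_low_rank.
pose g w : R := \sum_(j < M) \1_(F (rshift K t, j)) w.
have M0 : 0 <= M%:R^-1 :> R by rewrite invr_ge0.
(* Low-ranked test queries are covered, so the coverage count is bounded below by [g], a measurable
   function to which linearity of the integral applies. *)
apply: (@le_trans _ _ (\int[P]_w (M%:R^-1%:E * (g w)%:E))%E); last first.
  apply: ge0_le_integralT => w; rewrite -EFinM lee_fin.
    by rewrite mulr_ge0// sumr_ge0.
  rewrite ler_wpM2l// ler_sum// => j _; rewrite !indicE ler_nat.
  have [|//] := boolP (w \in F _); rewrite inE => Fw.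
  rewrite mem_set//; apply: score_le_pred_interval => //.
  exact: (score_le_threshold alpha_gt0 alpha_lt1 K_ge1 M_ge1 Fw).
have mg : measurable_fun setT g.
  by apply: measurable_sum => j; exact: measurable_indic.
rewrite ge0_integralZl_EFin//; last 2 first.
- by move=> w _; rewrite lee_fin sumr_ge0.
- exact/measurable_EFinP.
under eq_integral do rewrite -sumEFin.
rewrite ge0_integral_sum; last 3 first.
- by [].
- by move=> j; apply/measurable_EFinP; exact: measurable_indic.
- by move=> j w _; rewrite lee_fin.
have gI j : (\int[P]_w (\1_(F (rshift K t, j)) w)%:E = P (F (rshift K t, j)))%E.
  by rewrite integral_indic ?setIT.
under eq_bigr do rewrite gI.
have Jt : rshift K t \in cal_or_test (K := K) t by rewrite !inE eqxx orbT.
(* The rank is at most [K * M], hence at most the pool size [K.+1 * M]. *)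
have rJ : (quantile_rank alpha (K * M) <= #|cal_or_test (K := K) t| * M)%N.
  rewrite card_cal_or_test mulSn; apply: leq_trans (leq_addl _ _).
  by rewrite quantile_rank_le// muln_gt0 K_ge1.
(* The test unit has at least [r / K.+1] low-ranked queries on average; averaging over its queries
   supplies the factor [M%:R^-1]. *)
have := sum_probability_low_rank_ge D_exch mV Jt rJ.
rewrite card_cal_or_test => /(@lee_wpmul2l _ M%:R^-1%:E); rewrite lee_fin.
move=> /(_ M0); apply: le_trans.
by rewrite -EFinM lee_fin natrM invfM mulrA [leLHS]mulrC.
Qed.
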